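(* Given any integer $h \ge 1$, there exists a linear time $(1+\varepsilon)$-factor approximation algorithm for the $C(h,1,1)$-labelling problem for the class of finite trees with maximum degree $\Delta\ge 3$, where $\varepsilon = (2\Delta - 3)/(2\Delta + 4)$ ($\Delta$ being the maximum degree of the input tree). Moreover, this algorithm is a $1.4$-factor approximation algorithm for those finite trees with $\Delta_2 = 2\Delta - 1$ or $\Delta_2=2\Delta$.
   Context: For a finite tree $T$, $\Delta$ denotes its maximum degree and $\Delta_2 = \max_{uv \in E(T)}(d(u)+d(v))$, where $d(u)$ is the degree of $u$; $d(u,v)$ is the distance between $u$ and $v$. For a positive integer $\ell$, $|x|_\ell=\min\{|x|,\ell-|x|\}$. A $C(h_1,h_2,h_3)$-labelling of a graph $G$ with span $\ell$ is a mapping $f: V(G)\to\{0,1,\ldots,\ell-1\}$ such that for $i=1,2,3$ and any $u,v\in V(G)$ with $d(u,v)=i$ we have $|f(u)-f(v)|_\ell\ge h_i$. $\sigma_{h_1,h_2,h_3}(G)$ is the minimum integer $\ell$ such that $G$ admits a $C(h_1,h_2,h_3)$-labelling with span $\ell$. The $C(h,1,1)$-labelling problem: given a finite tree $T$, find a $C(h,1,1)$-labelling of $T$ of minimum span. A linear time $\rho$-factor approximation algorithm is one running in time linear in $|V(T)|$ that outputs a $C(h,1,1)$-labelling of $T$ with span at most $\rho\,\sigma_{h,1,1}(T)$. *)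

(* Defs.v *)
From HB Require Import structures.
From mathcomp Require Import all_boot all_order all_algebra.
Set Implicit Arguments.
Unset Strict Implicit.
Unset Printing Implicit Defensive.
Import Order.TTheory GRing.Theory Num.Theory.

(* Graphs on a finite vertex type, given by their adjacency relation. *)

Section Graphs.
Variables (V : finType) (e : rel V).

Definition deg (u : V) : nat := #|[set v | e u v]|.

Definition Delta : nat := \max_(u : V) deg u.

Definition Delta2 : nat := \max_(p : V * V | e p.1 p.2) (deg p.1 + deg p.2).

(* [ucycle e p] also holds of [:: u; v] for an edge uv, so a cycle of the graph
   is a [ucycle] with at least three vertices. *)
Definition is_tree : Prop :=
  [/\ symmetric e, irreflexive e, 0 < #|V|,
      forall u v, connect e u v
    & forall p : seq V, ucycle e p -> size p < 3].

Definition walk (n : nat) (u v : V) : bool :=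
  [exists p : n.-tuple V, path e u p && (last u p == v)].

(* d(u,v) = n; false for every n when u and v are not connected. *)
Definition at_dist (n : nat) (u v : V) : bool :=
  walk n u v && [forall m : 'I_n, ~~ walk m u v].

End Graphs.

(* |x|_l = min(|x|, l - |x|), meant for |x| <= l *)
Definition cycabs (l : nat) (x : int) : nat := minn `|x|%N (l - `|x|%N).

Lemma cycabs_mul H n a b :
  a < n -> b < n -> a != b ->
  H <= cycabs (H * n).+1 ((H * a)%N%:Z - (H * b)%N%:Z)%R.
Proof.
rewrite /cycabs; wlog ba : a b / b < a => [WL|] an bn ab.
  case: (ltngtP b a) => [lt_ba|lt_ab|eq_ab]; first exact: WL.
    by rewrite distnC; apply: WL => //; rewrite eq_sym.
  by rewrite eq_ab eqxx in ab.
rewrite distnEl; last by rewrite leq_mul2l (ltnW ba) orbT.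
have Hab : H * (a - b) + H <= H * n.
  by rewrite addnC -mulnS leq_mul2l (leq_ltn_trans (leq_subr _ _)) ?orbT.
rewrite -mulnBr leq_min leq_pmulr ?subn_gt0 //= leq_subRL.
  exact: leqW.
by rewrite leqW // (leq_trans (leq_addr _ _) Hab).
Qed.

Section Labellings.
Variables (V : finType) (e : rel V) (h1 h2 h3 : nat).

Definition C_labelling (l : nat) (f : {ffun V -> 'I_l}) : bool :=
  [forall u, forall v,
    let d := cycabs l ((f u)%:Z - (f v)%:Z)%R in
    [&& at_dist e 1 u v ==> (h1 <= d),
        at_dist e 2 u v ==> (h2 <= d)
      & at_dist e 3 u v ==> (h3 <= d)]].

Definition C_labellable (l : nat) : bool :=
  (0 < l) && [exists f : {ffun V -> 'I_l}, C_labelling f].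

Lemma at_dist_neq n u v : at_dist e n.+1 u v -> u != v.
Proof.
case/andP=> _ /forallP/(_ ord0) /existsP w0.
by apply/negP => /eqP uv; apply: w0; exists [tuple]; rewrite /= uv.
Qed.

Lemma ex_C_labellable : exists l, C_labellable l.
Proof.
pose H := maxn h1 (maxn h2 h3).
exists (H * #|V|).+1; rewrite /C_labellable /=; apply/existsP.
have lt_f (u : V) : H * enum_rank u < (H * #|V|).+1.
  by rewrite ltnS leq_mul2l ltnW ?orbT.
exists [ffun u => Ordinal (lt_f u)].
apply/forallP => u; apply/forallP => v; rewrite !ffunE /=.
set d := cycabs _ _.
have dH : u != v -> H <= d.
  by move=> uv; apply: cycabs_mul; rewrite // val_eqE (inj_eq enum_rank_inj).
have [H1 H2 H3] : [/\ h1 <= H, h2 <= H & h3 <= H].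
  by rewrite /H !leq_max !leqnn !orbT.
by apply/and3P; split; apply/implyP => /at_dist_neq/dH; apply: leq_trans.
Qed.

Definition sigma : nat := ex_minn ex_C_labellable.

End Labellings.

(* The machine model is a word RAM with uniform cost, programmed with structured
   control flow. A program mentions finitely many registers and arrays; cells
   hold natural numbers, subtraction is truncated, a nonzero value means true.
   Every node of an evaluated expression and every executed command or test
   costs one time unit. A word holds the values 0..W: execution is stuck as soon
   as a computed (sub)expression exceeds W. *)

Inductive expr : Type :=
  | EConst of nat
  | EReg of nat
  | ECell of nat & expr
  | EAdd of expr & expr
  | ESub of expr & expr.

Inductive cmd : Type :=
  | CSkip
  | CSet of nat & expr
  | CPut of nat & expr & expr
  | CSeq of cmd & cmd
  | CIf of expr & cmd & cmd
  | CWhile of expr & cmd.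

Record store : Type := Store { reg : nat -> nat; cell : nat -> nat -> nat }.

Definition set_reg (s : store) (x v : nat) : store :=
  Store (fun y => if y == x then v else reg s y) (cell s).

Definition set_cell (s : store) (a i v : nat) : store :=
  Store (reg s)
    (fun b j => if (b == a) && (j == i) then v else cell s b j).

Fixpoint eval (s : store) (x : expr) : nat :=
  match x with
  | EConst k => k
  | EReg r => reg s r
  | ECell a i => cell s a (eval s i)
  | EAdd x1 x2 => eval s x1 + eval s x2
  | ESub x1 x2 => eval s x1 - eval s x2
  end.

Fixpoint cost (x : expr) : nat :=
  match x with
  | EConst _ | EReg _ => 1
  | ECell _ i => (cost i).+1
  | EAdd x1 x2 | ESub x1 x2 => (cost x1 + cost x2).+1
  end.

Fixpoint fits (W : nat) (s : store) (x : expr) : bool :=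
  (eval s x <= W) &&
  match x with
  | EConst _ | EReg _ => true
  | ECell _ i => fits W s i
  | EAdd x1 x2 | ESub x1 x2 => fits W s x1 && fits W s x2
  end.

(* [exec W c s t s']: with word bound W, started in s, the program c halts in s'
   after exactly t time units. *)
Inductive exec (W : nat) : cmd -> store -> nat -> store -> Prop :=
  | ExecSkip s : exec W CSkip s 1 s
  | ExecSet r x s :
      fits W s x -> exec W (CSet r x) s (cost x).+1 (set_reg s r (eval s x))
  | ExecPut a i x s :
      fits W s i -> fits W s x ->
      exec W (CPut a i x) s (cost i + cost x).+1
        (set_cell s a (eval s i) (eval s x))
  | ExecSeq c1 c2 s1 s2 s3 t1 t2 :
      exec W c1 s1 t1 s2 -> exec W c2 s2 t2 s3 ->
      exec W (CSeq c1 c2) s1 (t1 + t2) s3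
  | ExecIf x c1 c2 s t s' :
      fits W s x -> exec W (if eval s x != 0 then c1 else c2) s t s' ->
      exec W (CIf x c1 c2) s (cost x + t).+1 s'
  | ExecWhileStop x c s :
      fits W s x -> eval s x = 0 -> exec W (CWhile x c) s (cost x).+1 s
  | ExecWhileStep x c s1 s2 s3 t1 t2 :
      fits W s1 x -> eval s1 x != 0 ->
      exec W c s1 t1 s2 -> exec W (CWhile x c) s2 t2 s3 ->
      exec W (CWhile x c) s1 (cost x + t1 + t2).+1 s3.

(* The execution from a given store, hence the output, is unique. *)
Lemma exec_fun W c s t s' u s'' :
  exec W c s t s' -> exec W c s u s'' -> t = u /\ s' = s''.
Proof.
move=> E; elim: E u s'' => {c s t s'}.
- by move=> s u s'' E; inversion E.
- by move=> r x s _ u s'' E; inversion E.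
- by move=> a i x s _ _ u s'' E; inversion E.
- move=> c1 c2 s1 s2 s3 t1 t2 _ IH1 _ IH2 u s'' E.
  inversion E as [| | |? ? ? ? ? ? ? E1 E2| | |]; subst.
  by have [? ?] := IH1 _ _ E1; subst; have [-> ->] := IH2 _ _ E2.
- move=> x c1 c2 s t s' _ _ IH u s'' E.
  inversion E as [| | | |? ? ? ? ? ? ? E1| |]; subst.
  by have [-> ->] := IH _ _ E1.
- move=> x c s _ x0 u s'' E.
  inversion E as [| | | | | |? ? ? ? ? ? ? ? xN0]; subst => //.
  by rewrite x0 in xN0.
- move=> x c s1 s2 s3 t1 t2 _ xN0 _ IH1 _ IH2 u s'' E.
  inversion E as [| | | | |? ? ? ? x0|? ? ? ? ? ? ? ? ? E1 E2]; subst.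
    by rewrite x0 in xN0.
  by have [? ?] := IH1 _ _ E1; subst; have [-> ->] := IH2 _ _ E2.
Qed.

(* Adjacency lists of a graph on {0,...,n-1}, the lists being in any order. *)
Definition adjacency_lists n (e : rel 'I_n) (N : 'I_n -> seq 'I_n) : Prop :=
  forall u, uniq (N u) /\ forall v, (v \in N u) = e u v.

(* Input: register 0 holds n; the neighbours of u are the entries of array 1 at
   the positions from (array 0)[u] to (array 0)[u+1] - 1; all other registers
   and cells hold 0. *)
Definition input n (N : 'I_n -> seq 'I_n) : store :=
  let lists : seq (seq nat) := [seq map val (N u) | u <- enum 'I_n] in
  let offsets := [seq sumn (take i (shape lists)) | i <- iota 0 n.+1] in
  Store (fun r => if r == 0 then n else 0)
        (fun a i => if a == 0 then nth 0 offsets i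
                    else if a == 1 then nth 0 (flatten lists) i
                    else 0).

(* Output: the span l in register 0 and the labels of 0,...,n-1 in array 2. *)
Definition outputs n (s : store) (l : nat) (f : {ffun 'I_n -> 'I_l}) : Prop :=
  reg s 0 = l /\ forall v : 'I_n, cell s 2 v = f v.

(* [P] is a linear-time [rho]-approximation for the C(h,1,1)-labelling problem on
   the trees in the class [K]: c * n time units suffice on words of logarithmic
   length (values up to c * n ^ k). *)
Definition linear_time_approx (h : nat) (P : cmd)
    (K : forall n, rel 'I_n -> Prop) (rho : forall n, rel 'I_n -> rat) : Prop :=
  exists c k : nat,
  forall (n : nat) (e : rel 'I_n) (N : 'I_n -> seq 'I_n),
    is_tree e -> K n e -> adjacency_lists e N ->
    exists (t : nat) (s : store) (l : nat) (f : {ffun 'I_n -> 'I_l}),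
      [/\ exec (c * n ^ k) P (input N) t s, t <= c * n,
          outputs s f, C_labelling e h 1 1 f
        & (l%:R <= rho n e * (sigma e h 1 1)%:R)%R].

(* Main.v *)
Require Import Defs.
From mathcomp Require Import all_boot all_order all_algebra.
From mathcomp Require Import zify lra.
Set Implicit Arguments.
Unset Strict Implicit.
Unset Printing Implicit Defensive.
Import Order.POrderTheory GRing.Theory Num.Theory.

(** The span l returned by the algorithm is the least number such that
    l >= deg u + 2h - 1 for every vertex u and l >= deg u + deg v + h - 1 for
    every edge uv ([roomy]).

    This span is at most 5/4 of the optimum ([roomy_sigma]).  In a labelling of
    span s, the neighbours of u have distinct labels outside an arc of 2h - 1
    labels around the label of u, so s >= deg u + 2h - 1; and the
    neighbourhoods of the ends of an edge uv are disjoint and pairwise within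
    distance three, so s >= deg u + deg v.  Three times the latter, plus the
    former at u and at v, gives 4 (deg u + deg v + h - 1) < 5 s.  For Delta >= 3
    both 7/5 and 1 + (2 Delta - 3) / (2 Delta + 4) are at least 5/4.

    A labelling of span l is found from the root downwards.  The labels of the
    neighbours of u are made to fill an arc A_u of the cycle Z_l, of length
    deg u.  Writing B_w for the labels closer than h to the label of w, it is
    enough that A_u avoids B_u, that A_u and A_w are disjoint for each edge uw,
    and that each A_u holds the labels of all the neighbours of u.  Let w be a
    child of u.  The label of w lies in A_u, so A_u and B_w overlap and their
    union is an arc of length at most max (deg u) h + h - 1; its complement is
    an arc that contains the label of u, and it has room for deg w labels by
    the choice of l.  So A_w can be chosen there with the label of u inside
    ([child_arc]).  This is where intervals help: a greedy choice
    of arbitrary sets A_u would need 2h - 2 extra labels instead of h - 1.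

    The program first computes l by running over all adjacency lists
    ([runs_span]), then visits the tree breadth first and computes arcs and
    labels with a bounded number of operations per adjacency entry
    ([runs_place_loop]).  A tree has at most 2n adjacency entries
    ([sum_deg_le]), hence linear time; every stored number is at most a
    constant times n. *)

(** * Rooted trees *)

Lemma deg_gt0 (V : finType) (e : rel V) u v : e u v -> 0 < deg e u.
Proof. by move=> uv; apply/card_gt0P; exists v; rewrite inE. Qed.

Section Trees.
Variables (V : finType) (e : rel V).
Hypothesis tree : is_tree e.

(** Every edge of a tree is a bridge: were uv not an edge of t, a t-path from
    u to v could be shortened and closed by uv into a cycle. *)
Lemma connecting_subrel_edge (t : rel V) u v :
  subrel t e -> connect t u v -> e u v -> t u v.
Proof.
case: tree => sym irr _ _ acyclic te /connectP[p pth ->].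
case: (shortenP pth) => p' pth' uniq_p' _ {p pth}.
case: p' pth' uniq_p' => [|w [|w' p']] /=; first by rewrite irr.
  by rewrite andbT.
move=> pth' uniq_p' elast.
suff /acyclic : ucycle e [:: u, w, w' & p'] by [].
rewrite /ucycle; apply/andP; split => //=.
rewrite rcons_path; case/and3P: pth' => /te-> /te-> /(sub_path te)->.
by rewrite /= sym.
Qed.

(** Let the parent of u be a neighbour closer to r.  The parent edges connect
    every vertex to r, so by [connecting_subrel_edge] the tree has no other
    edges. *)
Lemma tree_parents r :
  exists (par : V -> V) (depth : V -> nat),
    (forall u, u != r -> depth u = (depth (par u)).+1) /\
    (forall u v, e u v =
       ((u != r) && (par u == v)) || ((v != r) && (par v == u))).
Proof.
case: (tree) => sym irr _ conn _.
have ex u : exists m, walk e m u r.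
  case/connectP: (conn u r) => p pth rE; exists (size p).
  by apply/existsP; exists (in_tuple p); rewrite /= pth rE /=.
pose depth u := ex_minn (ex u).
have depth_walk u : walk e (depth u) u r by rewrite /depth; case: ex_minnP.
have depth_le u m : walk e m u r -> depth u <= m.
  by rewrite /depth; case: ex_minnP => m' _; apply.
have walkS m u v : e u v -> walk e m v r -> walk e m.+1 u r.
  move=> uv /existsP[p /andP[pth lst]]; apply/existsP; exists [tuple of v :: p].
  by rewrite /= uv pth.
have step u : u != r -> exists v, e u v && (depth u == (depth v).+1).
  move=> ur; have := depth_walk u; case Ed: (depth u) => [|m] /existsP[p].
    by rewrite tuple0 /= (negbTE ur).
  case: p => [[|v p] //= sz] /andP[/andP[uv pth] lst]; exists v; rewrite uv /=.
  have := depth_le u _ (walkS _ _ _ uv (depth_walk v)); rewrite Ed ltnS => le1.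
  rewrite eqSS eqn_leq le1; apply: depth_le.
  by apply/existsP; exists (Tuple (sz : size p == m)); rewrite pth.
pose par u := odflt u [pick v | e u v && (depth u == (depth v).+1)].
have parP u : u != r -> e u (par u) /\ depth u = (depth (par u)).+1.
  move/step=> ex_v; rewrite /par; case: pickP => [v /andP[? /eqP ?] //|no].
  by case: ex_v => v; rewrite no.
exists par, depth; split=> [u /parP[]//|].
pose t u v := (u != r) && (par u == v) || (v != r) && (par v == u).
have te : subrel t e.
  move=> u v /orP[] /andP[/parP[uv _] /eqP <- //].
  by rewrite sym.
have t_sym : connect_sym t by apply: sym_connect_sym => u v; rewrite /t orbC.
have t_root u : connect t u r.
  have [m] := ubnP (depth u); elim: m u => // m IH u lem.
  have [->|ur] := eqVneq u r; first exact: connect0.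
  have [_ du] := parP _ ur.
  apply: (@connect_trans _ _ (par u)); last by apply: IH; lia.
  by apply: connect1; rewrite /t ur eqxx.
move=> u v; apply/idP/idP => [uv|/te//].
apply: connecting_subrel_edge te _ uv.
by apply: connect_trans (t_root u) _; rewrite t_sym.
Qed.

(** Every neighbour of u is its parent or one of its children, and each vertex
    is counted once as a child. *)
Lemma sum_deg_le : \sum_u deg e u <= 2 * #|V|.
Proof.
have [_ _ /card_gt0P[r _] _ _] := tree.
have [par [depth [_ edge]]] := tree_parents r.
have le_deg u : deg e u <= 1 + \sum_v (par v == u).
  have -> : \sum_v (par v == u) = #|[set v | par v == u]|.
    by rewrite -sum1dep_card [RHS]big_mkcond /=; apply: eq_bigr => v _; case: eqP.
  apply: (@leq_trans #|par u |: [set v | par v == u]|).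
    apply: subset_leq_card; apply/subsetP => v.
    by rewrite !inE edge => /orP[] /andP[_ /eqP ->]; rewrite eqxx ?orbT.
  by rewrite cardsU1 leq_add2r leq_b1.
apply: (@leq_trans (\sum_u (1 + \sum_v (par v == u)))).
  by apply: leq_sum => u _; apply: le_deg.
rewrite big_split /= sum1_card exchange_big /= mul2n -addnn leq_add2l.
rewrite -sum1_card; apply: leq_sum => v _.
by rewrite (bigD1 (par v)) //= eqxx big1 // => u /negbTE; rewrite eq_sym => ->.
Qed.

End Trees.

(** * Labellings in which neighbourhoods fill arcs *)

(** The common form of every distance estimate below: both labels are written
    as offsets from the start s of an arc, so that cyclic distance reduces to
    the difference of the offsets. *)
Lemma cycabs_arc l s i j k :
  i + k <= j -> j + k <= l + i ->
  k <= cycabs l (((s + i) %% l)%N%:Z - ((s + j) %% l)%N%:Z)%R.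
Proof.
move=> ij ji; case: k ij ji => // k ij ji.
have -> : (s + j) %% l = ((s + i) %% l + (j - i)) %% l.
  by rewrite modnDml; congr (_ %% _); lia.
have al : (s + i) %% l < l by rewrite ltn_mod; lia.
move: (_ %% l) al => a al; rewrite /cycabs.
have [lt|ge] := ltnP (a + (j - i)) l.
  by rewrite (modn_small lt); lia.
have -> : (a + (j - i)) %% l = a + (j - i) - l.
  by rewrite -{1}(subnK ge) modnDr modn_small //; lia.
lia.
Qed.

Lemma cycabsC l a b : cycabs l (a%:Z - b%:Z)%R = cycabs l (b%:Z - a%:Z)%R.
Proof. by rewrite /cycabs distnC. Qed.

Lemma cycabs_neq l s i j : i < l -> j < l -> i != j ->
  0 < cycabs l (((s + i) %% l)%N%:Z - ((s + j) %% l)%N%:Z)%R.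
Proof.
move=> il jl; rewrite neq_ltn => /orP[] ij; last rewrite cycabsC; apply: cycabs_arc; lia.
Qed.

(** The condition is written additively, as l + 1 >= deg u + 2h and
    l + 1 >= deg u + deg v + h, to stay clear of truncated subtraction. *)
Definition roomy (V : finType) (e : rel V) (h l : nat) : Prop :=
  (forall u, deg e u + 2 * h <= l.+1) /\
  (forall u v, e u v -> deg e u + deg e v + h <= l.+1).

(** What is fixed about a vertex u when it receives its label.  The labels of
    its neighbours will be [first], ..., [first] + deg u - 1 modulo l; the
    parent holds the one at offset [ppos], and [anchor] is the offset of the
    label of u itself, which lies outside this arc.  Keeping the offsets besides
    the labels makes all comparisons below comparisons of plain integers. *)
Record plan : Type := Plan
  { label : nat; first : nat; ppos : nat; anchor : nat }.

(** [ppos] = deg u is past the end of the arc: no offset is reserved. *)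
Definition root_plan h l d : plan := Plan 0 h d (l - h).

(** The offset, from the start of the arc of the parent u, at which the arc of
    a child w begins; i is the offset of the label of w and d its degree.  Going
    up from the arc of u and around the cycle, the labels that w and the arc of
    u exclude are met again at offset l - (h - 1 - i), so l - (h - 1 - i) - d is
    the last admissible start; it is lowered to the offset of the label of u if
    it exceeds it, so that this label is covered. *)
Definition child_first h l a i d := minn (anchor a) (l - (h.-1 - i) - d).

Definition child_plan h l a i d : plan :=
  let t := child_first h l a i d in
  Plan ((first a + i) %% l) ((first a + t) %% l) (anchor a - t) (i + l - t).

(** The last two conditions keep the labels closer than h to the label of the
    vertex off its arc, on either side. *)
Definition sound_plan h l d (a : plan) : Prop :=
  [/\ label a = (first a + anchor a) %% l, first a < l,
      d + h <= anchor a + 1 & anchor a + h <= l].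

Lemma sound_root_plan h l d :
  0 < h -> d + 2 * h <= l.+1 -> 0 < d -> sound_plan h l d (root_plan h l d).
Proof.
move=> h0 dl d0; split=> /=; try lia.
by rewrite subnKC ?modnn //; lia.
Qed.

Lemma child_first_bounds h l a i d :
  child_first h l a i d <= anchor a /\ child_first h l a i d <= l.
Proof. by rewrite /child_first; lia. Qed.

Section ChildPlan.
Variables (h l du dw i : nat) (a : plan).
Hypotheses (h0 : 0 < h) (du_dw : du + dw + h <= l.+1) (dw_l : dw + 2 * h <= l.+1).
Hypotheses (dw0 : 0 < dw) (sa : sound_plan h l du a).
Hypothesis i_du : i < du.

(** In offsets from the start of the arc of the parent, the arc of the child
    is [t, t + dw): it follows the arc [0, du) of the parent, stays below l,
    contains the label of the parent, and keeps distance h from the offset i of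
    the label of the child. *)
Lemma child_arc :
  let t := child_first h l a i dw in
  [/\ du <= t, t + dw <= l, t <= anchor a < t + dw,
      i + h <= t & t + dw + h <= l + i + 1].
Proof. by case: sa => _ _ a1 a2; rewrite /child_first /=; split; lia. Qed.

Lemma sound_child_plan : sound_plan h l dw (child_plan h l a i dw).
Proof.
have [] := child_arc; case: sa => _ fl a1 a2.
rewrite /child_plan; move: (child_first _ _ _ _ _) => t t1 t2 /andP[t3 t4] t5 t6.
split=> /=; try lia.
rewrite modnDml -addnA subnKC; last by lia.
by rewrite addnA modnDr.
Qed.

Lemma parent_label_child :
  label a = (first (child_plan h l a i dw) + ppos (child_plan h l a i dw)) %% l.
Proof.
have [] := child_arc; case: sa => -> _ _ _.
rewrite /child_plan; move: (child_first _ _ _ _ _) => t t1 t2 /andP[t3 t4] t5 t6 /=.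
by rewrite modnDml -addnA subnKC.
Qed.

Lemma ppos_child : ppos (child_plan h l a i dw) < dw.
Proof. by have [] := child_arc; rewrite /=; lia. Qed.

End ChildPlan.

Section TreeLabelling.
Variables (V : finType) (e : rel V) (h l : nat) (r : V) (par : V -> V).
Variables (depth : V -> nat) (N : V -> seq V).
Hypothesis depthS : forall u, u != r -> depth u = (depth (par u)).+1.
Hypothesis edge : forall u v,
  e u v = ((u != r) && (par u == v)) || ((v != r) && (par v == u)).
Hypothesis adj : forall u, uniq (N u) /\ forall v, (v \in N u) = e u v.

Definition is_parent u v := (u != r) && (par u == v).

Definition kids u := [seq v <- N u | ~~ is_parent u v].

Lemma size_adj u : size (N u) = deg e u.
Proof.
have [uN memN] := adj u; rewrite /deg cardsE -(card_uniqP uN).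
by apply: eq_card => v; rewrite memN.
Qed.

Lemma mem_kids u v : (v \in kids u) = is_parent v u.
Proof.
rewrite mem_filter (adj u).2 edge /is_parent.
case: (boolP ((v != r) && _)) => [/andP[vr /eqP vu]|_]; last first.
  by rewrite orbF andNb.
rewrite orbT andbT; apply/negP => /andP[ur /eqP uv].
by have := depthS vr; have := depthS ur; rewrite vu uv; lia.
Qed.

Lemma uniq_kids u : uniq (kids u).
Proof. by rewrite filter_uniq // (adj u).1. Qed.

Lemma size_kids u : (u != r) + size (kids u) = deg e u.
Proof.
rewrite -size_adj -(count_predC (is_parent u) (N u)) size_filter; congr (_ + _).
case: (eqVneq u r) => [->|ur] /=.
  by rewrite (eq_count (a2 := pred0)) ?count_pred0 // => v; rewrite /= /is_parent eqxx.
rewrite (eq_count (a2 := pred1 (par u))); last first.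
  by move=> v; rewrite /= /is_parent ur eq_sym.
by rewrite count_uniq_mem ?(adj u).1 // (adj u).2 edge ur eqxx.
Qed.

Lemma edge_sym u v : e u v = e v u.
Proof. by rewrite !edge orbC. Qed.

Lemma is_parent_edge u v : is_parent u v -> e u v.
Proof. by rewrite edge /is_parent => ->. Qed.

(** The children of u take the offsets of its arc in adjacency order, with
    [bump] skipping the offset held by the parent.  The recursion climbs to the
    root; its fuel is the depth. *)
Fixpoint plan_rec k v : plan :=
  if v == r then root_plan h l (deg e r) else
  if k is k'.+1 then
    let a := plan_rec k' (par v) in
    child_plan h l a (bump (ppos a) (index v (kids (par v)))) (deg e v)
  else root_plan h l 0.

Definition plan_of v := plan_rec (depth v) v.

Definition pos u v :=
  if is_parent u v then ppos (plan_of u)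
  else bump (ppos (plan_of u)) (index v (kids u)).

Lemma plan_of_root : plan_of r = root_plan h l (deg e r).
Proof. by rewrite /plan_of; case: (depth r) => /=; rewrite eqxx. Qed.

Lemma plan_of_child u v : is_parent v u ->
  plan_of v = child_plan h l (plan_of u) (pos u v) (deg e v).
Proof.
move=> vu; have /andP[vr /eqP <-] := vu.
rewrite /plan_of depthS //= (negbTE vr) /pos.
have : v \in kids (par v) by rewrite mem_kids /is_parent vr eqxx.
by rewrite mem_filter => /andP[/negbTE-> _].
Qed.

Hypotheses (h0 : 0 < h) (room : roomy e h l) (deg_r : 0 < deg e r).

(** Stated with a hypothesis on [ppos] because it serves inside the induction
    that establishes it.  At the root [bump] never skips, and elsewhere one of
    the deg u offsets is left to the parent. *)
Lemma ppos_kids u : u = r \/ ppos (plan_of u) < deg e u ->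
  forall v, e u v -> pos u v < deg e u.
Proof.
move=> pu v uv; rewrite /pos; case: ifPn => [|vu].
  by case: pu => [->|//]; rewrite /is_parent eqxx.
have : index v (kids u) < size (kids u).
  by rewrite index_mem mem_filter vu (adj u).2.
have := size_kids u; rewrite /bump; case: eqVneq pu => [->|ur [E|]] /=.
- by rewrite plan_of_root /= => _; lia.
- by rewrite E eqxx in ur.
- by lia.
Qed.

Lemma plan_sound u :
  sound_plan h l (deg e u) (plan_of u) /\ (u = r \/ ppos (plan_of u) < deg e u).
Proof.
have [m] := ubnP (depth u); elim: m u => // m IH u lem.
have [->|ur] := eqVneq u r.
  rewrite plan_of_root; split; last by left.
  by apply: sound_root_plan; rewrite // room.1.
have pu : is_parent u (par u) by rewrite /is_parent ur eqxx.
have eu := is_parent_edge pu; have eu' := eu; rewrite edge_sym in eu'.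
have [|sp pp] := IH (par u); first by have := depthS ur; lia.
have lt := ppos_kids pp eu'; rewrite (plan_of_child pu).
split; first by apply: (sound_child_plan _ (room.2 _ _ eu') (room.1 u) (deg_gt0 eu) sp).
by right; apply: (ppos_child _ (room.2 _ _ eu') (room.1 u) (deg_gt0 eu) sp).
Qed.

Lemma pos_lt u v : e u v -> pos u v < deg e u.
Proof. by apply: ppos_kids; have [] := plan_sound u. Qed.

Lemma pos_inj u v w : e u v -> e u w -> pos u v = pos u w -> v = w.
Proof.
move=> uv uw; rewrite /pos.
case: ifPn => [/andP[_ /eqP<-]|nv]; case: ifPn => [/andP[_ /eqP<-]|nw] //.
- by move=> E; have := neq_bump (ppos (plan_of u)) (index w (kids u)); rewrite -E eqxx.
- by move=> E; have := neq_bump (ppos (plan_of u)) (index v (kids u)); rewrite E eqxx.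
have vk : v \in kids u by rewrite mem_filter nv (adj u).2.
have wk : w \in kids u by rewrite mem_filter nw (adj u).2.
by move/(can_inj (bumpK _)); apply: index_inj.
Qed.

(** For a child of u this is how its label was chosen; for the parent of u it
    says that the arc of u was placed around the label of the parent. *)
Lemma label_pos u v : e u v ->
  label (plan_of v) = (first (plan_of u) + pos u v) %% l.
Proof.
have child w x : is_parent w x -> label (plan_of w) = (first (plan_of x) + pos x w) %% l.
  by move/plan_of_child->.
rewrite edge => /orP[uv|/child //].
have vu := is_parent_edge uv; have vu' := vu; rewrite edge_sym in vu'.
have [sp _] := plan_sound v.
have -> : pos u v = ppos (plan_of u) by rewrite /pos /is_parent uv.
rewrite (plan_of_child uv).
exact: (parent_label_child h0 (room.2 _ _ vu') (room.1 u) (deg_gt0 vu) sp (pos_lt vu')).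
Qed.

Lemma label_lt u : label (plan_of u) < l.
Proof.
have [[-> fl _ _] _] := plan_sound u; rewrite ltn_mod; exact: leq_ltn_trans fl.
Qed.

Lemma label_gap_dist1 u v : e u v ->
  h <= cycabs l ((label (plan_of u))%:Z - (label (plan_of v))%:Z)%R.
Proof.
move=> uv; have [[-> fl a1 a2] _] := plan_sound u.
rewrite (label_pos uv) cycabsC; have lt := pos_lt uv.
by apply: cycabs_arc; lia.
Qed.

Lemma deg_lt u : deg e u < l.
Proof. have [[_ _ a1 a2] _] := plan_sound u; lia. Qed.

Lemma label_gap_dist2 u v w : e u v -> e u w -> v != w ->
  0 < cycabs l ((label (plan_of v))%:Z - (label (plan_of w))%:Z)%R.
Proof.
move=> uv uw vw; rewrite (label_pos uv) (label_pos uw).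
have dl := deg_lt u; have := pos_lt uv; have := pos_lt uw => ? ?.
apply: cycabs_neq; [lia | lia |].
by apply: contra vw => /eqP/(pos_inj uv uw)->.
Qed.

(** Assume that v is a child of u.  Its arc begins, seen from the arc of u,
    after the last neighbour of u and ends before offset l. *)
Lemma label_gap_dist3 u v x y : e u v -> e u x -> e v y ->
  0 < cycabs l ((label (plan_of x))%:Z - (label (plan_of y))%:Z)%R.
Proof.
wlog vu : u v x y / is_parent v u => [WL|] uv ux vy.
  have := uv; rewrite edge => /orP[] pa; last exact: WL pa _ _ _.
  by rewrite cycabsC; apply: WL pa _ _ _; rewrite // edge_sym.
have [sp _] := plan_sound u.
have lx := pos_lt ux; have ly := pos_lt vy; have lv := pos_lt uv.
rewrite (label_pos ux) (label_pos vy) (plan_of_child vu) /= modnDml -addnA.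
have vu' := uv; rewrite edge_sym in vu'.
have [] := child_arc h0 (room.2 _ _ uv) (room.1 v) (deg_gt0 vu') sp lv.
by move: (child_first _ _ _ _ _) => t *; apply: cycabs_neq; lia.
Qed.

Lemma C_labelling_plan (f : {ffun V -> 'I_l}) :
  (forall u, f u = label (plan_of u) :> nat) -> C_labelling e h 1 1 f.
Proof.
move=> fE; apply/forallP => u; apply/forallP => v; rewrite !fE /=.
have walkP m : walk e m u v ->
    exists p : seq V, [/\ size p = m, path e u p & last u p = v].
  by case/existsP=> p /andP[? /eqP ?]; exists p; rewrite size_tuple.
apply/and3P; split; apply/implyP => d; have uv := at_dist_neq d; move: d uv;
  case/andP=> /walkP[p [sz pth lst]] _;
  case: p sz pth lst => [|x [|y [|z []]]] //= _.
- by rewrite andbT => ux <- _; apply: label_gap_dist1.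
- by move=> /and3P[ux xy _] <- uy; apply: (label_gap_dist2 _ xy uy); rewrite edge_sym.
- by move=> /and4P[ux xy yz _] <- _; apply: (label_gap_dist3 xy _ yz); rewrite edge_sym.
Qed.

End TreeLabelling.

(** * Lower bounds on the span *)

Section LowerBound.
Variables (V : finType) (e : rel V) (h l : nat) (f : {ffun V -> 'I_l}).
Hypotheses (tree : is_tree e) (h0 : 0 < h) (lab : C_labelling e h 1 1 f).

Lemma label_gap_edge u v :
  e u v -> h <= cycabs l ((f u)%:Z - (f v)%:Z)%R.
Proof.
have [_ irr _ _ _] := tree; move=> uv.
have /forallP/(_ u)/forallP/(_ v)/and3P[/implyP H _ _] := lab; apply: H.
rewrite /at_dist; apply/andP; split.
  by apply/existsP; exists [tuple v]; rewrite /= uv eqxx.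
apply/forallP => -[[|//] lt] /=; apply/existsP => -[p].
by rewrite tuple0 /= => /eqP vu; rewrite vu irr in uv.
Qed.

(** The distance between u and v is 1, 2 or 3, and each of the three
    conditions excludes equal labels. *)
Lemma label_neq u v p :
  path e u p -> last u p = v -> size p <= 3 -> u != v -> f u != f v.
Proof.
move=> pth lst sz uv.
have ex : exists m, walk e m u v.
  by exists (size p); apply/existsP; exists (in_tuple p); rewrite /= pth lst /=.
case: (ex_minnP ex) => m w minm.
have m3 : m <= 3.
  apply: leq_trans sz; apply: minm.
  by apply/existsP; exists (in_tuple p); rewrite /= pth lst /=.
have d : at_dist e m u v.
  rewrite /at_dist w /=; apply/forallP => -[k km] /=; apply/negP => /minm; lia.
apply/eqP => fE.
have /forallP/(_ u)/forallP/(_ v) := lab.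
have -> : cycabs l ((f u)%:Z - (f v)%:Z)%R = 0 by rewrite fE /cycabs; lia.
case: m {w minm} m3 d => [|[|[|[|//]]]] _ d.
  by case/andP: d => /existsP[q]; rewrite tuple0 /= (negbTE uv).
all: rewrite d /=.
- by rewrite leqNgt h0.
- by rewrite andbF.
- by rewrite !andbF.
Qed.

(** Rotate the labels so that u gets 0: its neighbours then have distinct
    labels between h and l - h. *)
Lemma span_ge_star u : 0 < deg e u -> deg e u + 2 * h <= l.+1.
Proof.
have [sym irr _ _ _] := tree.
move=> d0; pose g v := ((f v + (l - f u)) %% l)%N.
have gP v : e u v -> h <= g v /\ g v + h <= l.
  move/label_gap_edge; rewrite /g /cycabs.
  have := ltn_ord (f u); have := ltn_ord (f v).
  move: (nat_of_ord (f u)) (nat_of_ord (f v)) => a b bl al gap.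
  have [lt|ge] := ltnP (b + (l - a)) l; first by rewrite modn_small //; lia.
  by rewrite -(subnK ge) modnDr modn_small; lia.
have g_inj : {in [pred v | e u v] &, injective g}.
  move=> v w; rewrite !inE => uv uw gE; apply/eqP; apply: contraT => vw.
  have pth : path e v [:: u; w] by rewrite /= sym uv uw.
  have /negP[] := label_neq pth erefl isT vw.
  apply/eqP; apply: val_inj => /=; move/eqP: gE; rewrite /g eqn_modDr.
  by rewrite !modn_small // => /eqP.
have l_ge : 2 * h <= l.
  by case/card_gt0P: d0 => v; rewrite inE => /gP; lia.
have sub : {subset [seq g v | v in [pred v | e u v]] <= iota h (l.+1 - 2 * h)}.
  by move=> x /imageP[v]; rewrite !inE => uv ->; rewrite mem_iota; have := gP _ uv; lia.
have := uniq_leq_size _ sub; rewrite size_iota size_image => /(_ _) H.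
suff : deg e u <= l.+1 - 2 * h by lia.
rewrite /deg cardsE; apply: H; rewrite map_inj_in_uniq ?enum_uniq //.
by move=> v w; rewrite !mem_enum; apply: g_inj.
Qed.

(** Two neighbours of u or v are joined by a walk of length at most three, and
    no vertex is adjacent to both ends because there are no triangles. *)
Lemma span_ge_edge u v : e u v -> deg e u + deg e v <= l.
Proof.
have [sym irr _ _ acyclic] := tree.
move=> uv; have vu : e v u by rewrite sym.
have disj : [set x | e u x] :&: [set x | e v x] = set0.
  apply/setP => x; rewrite !inE; apply/negP => /andP[ux vx].
  suff /acyclic : ucycle e [:: u; x; v] by [].
  rewrite /ucycle /= ux vu sym vx !inE /= andbT negb_or.
  apply/andP; split; [apply/andP; split|]; apply/eqP => E; subst.
  - by rewrite irr in ux.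
  - by rewrite irr in uv.
  - by rewrite irr in vx.
rewrite /deg -cardsUI disj cards0 addn0 -[leqRHS]card_ord.
rewrite -(card_in_imset (f := f)) ?max_card // => x y.
rewrite !inE => Nx Ny fE; apply/eqP; apply: contraT => xy.
have [p [pth lst sz]] : exists p, [/\ path e x p, last x p = y & size p <= 3].
  have [xu|xv] := orP Nx; have [yu|yv] := orP Ny.
  - by exists [:: u; y]; rewrite /= sym xu yu.
  - by exists [:: u; v; y]; rewrite /= sym xu uv yv.
  - by exists [:: v; u; y]; rewrite /= sym xv vu yu.
  - by exists [:: v; y]; rewrite /= sym xv yv.
by have := label_neq pth lst sz xy; rewrite fE eqxx.
Qed.

End LowerBound.

(** As the span computed by the program is the least roomy number, this is the
    approximation ratio. *)
Lemma roomy_sigma (V : finType) (e : rel V) h :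
  is_tree e -> 0 < h -> 0 < Delta e -> roomy e h ((5 * sigma e h 1 1) %/ 4).
Proof.
move=> tree h0 D0; rewrite /sigma; case: ex_minnP => l /andP[l0 /existsP[f lab]] _.
have star u : deg e u + 2 * h <= l.+1.
  have [d0|] := posnP (deg e u); last exact: (span_ge_star tree h0 lab).
  have [_ _ V0 _ _] := tree.
  (* An isolated vertex is bounded through a vertex of maximum degree. *)
  have [w Dw] := eq_bigmax (deg e) V0; rewrite -/(Delta e) in Dw.
  have := span_ge_star tree h0 lab (u := w); lia.
split=> [u|u v uv]; first by have := star u; lia.
have [sym _ _ _ _] := tree; have vu : e v u by rewrite sym.
have := span_ge_edge tree h0 lab uv; have := star u; have := star v.
by have := deg_gt0 uv; have := deg_gt0 vu; lia.
Qed.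

(** * Timed execution of programs *)

Fixpoint consts_le (M : nat) (x : expr) : bool :=
  match x with
  | EConst k => k <= M
  | EReg _ => true
  | ECell _ i => consts_le M i
  | EAdd x1 x2 | ESub x1 x2 => consts_le M x1 && consts_le M x2
  end.

Definition bounded (M : nat) (s : store) : Prop :=
  (forall x, reg s x <= M) /\ (forall a i, cell s a i <= M).

(** Worst-case time of a loop-free command, computable by reduction. *)
Fixpoint ctime (c : cmd) : nat :=
  match c with
  | CSkip => 1
  | CSet _ x => (cost x).+1
  | CPut _ i x => (cost i + cost x).+1
  | CSeq c1 c2 => ctime c1 + ctime c2
  | CIf x c1 c2 => (cost x + maxn (ctime c1) (ctime c2)).+1
  | CWhile _ _ => 0
  end.

(** Instead of following the size of every subexpression, only the stored values
    are kept below M: a subexpression with k nodes then has value at most k * M.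
    The expressions of the program have at most 64 nodes, so words up to
    W >= 64 * M suffice. *)
Section Logic.
Variables (M W : nat).
Hypothesis MW : 64 * M <= W.

Lemma eval_bounded s x : bounded M s -> consts_le M x -> eval s x <= cost x * M.
Proof.
move=> [bR bC]; elim: x => [k|r|a i IH|x1 IH1 x2 IH2|x1 IH1 x2 IH2] /=.
- by rewrite mul1n.
- by rewrite mul1n.
- by move=> _; apply: leq_trans (bC _ _) _; rewrite mulSn leq_addr.
- by case/andP=> /IH1 ? /IH2 ?; nia.
- by case/andP=> /IH1 ? /IH2 ?; nia.
Qed.

Lemma fits_bounded s x :
  bounded M s -> consts_le M x -> cost x <= 64 -> fits W s x.
Proof.
move=> bd; have ev y : consts_le M y -> cost y <= 64 -> eval s y <= W.
  by move=> /(eval_bounded bd) ? ?; nia.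
elim: x => [k|r|a i IH|x1 IH1 x2 IH2|x1 IH1 x2 IH2] cx sx;
  (apply/andP; split; first exact: ev); move: cx sx => //=.
- by move=> ? ?; apply: IH => //; lia.
- by case/andP=> ? ? ?; apply/andP; split; [apply: IH1 | apply: IH2] => //; lia.
- by case/andP=> ? ? ?; apply/andP; split; [apply: IH1 | apply: IH2] => //; lia.
Qed.

(** Total correctness within T time units, from stores with values at most M to
    stores with values at most M. *)
Definition runs c s T (P : store -> Prop) : Prop :=
  bounded M s ->
  exists t s', [/\ exec W c s t s', t <= T, bounded M s' & P s'].

Lemma runs_weaken c s T T' (P P' : store -> Prop) :
  T <= T' -> (forall s', P s' -> P' s') -> runs c s T P -> runs c s T' P'.
Proof.
move=> TT PP R /R[t [s' [E tT bs Ps]]]; exists t, s'; split=> //; last exact: PP.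
exact: leq_trans tT TT.
Qed.

Lemma runs_skip s (P : store -> Prop) : P s -> runs CSkip s (ctime CSkip) P.
Proof. by move=> Ps bs; exists 1, s; split=> //; constructor. Qed.

Lemma runs_set r x v s (P : store -> Prop) :
  eval s x = v -> v <= M -> consts_le M x && (cost x <= 64) ->
  P (set_reg s r v) ->
  runs (CSet r x) s (ctime (CSet r x)) P.
Proof.
move=> <- vM /andP[cx sx] Ps [bR bC]; eexists _, _; split; [|exact: leqnn| |exact: Ps].
  by constructor; apply: fits_bounded.
by split=> //= y; case: eqP.
Qed.

Lemma runs_put a i x k v s (P : store -> Prop) :
  eval s i = k -> eval s x = v -> v <= M ->
  [&& consts_le M i, cost i <= 64, consts_le M x & cost x <= 64] ->
  P (set_cell s a k v) ->
  runs (CPut a i x) s (ctime (CPut a i x)) P.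
Proof.
move=> <- <- vM /and4P[ci si cx sx] Ps [bR bC].
eexists _, _; split; [|exact: leqnn| |exact: Ps].
  by constructor; apply: fits_bounded.
by split=> //= b y; case: (_ && _).
Qed.

Lemma runs_seq c1 c2 s T1 T2 (P : store -> Prop) :
  runs c1 s T1 (fun s' => runs c2 s' T2 P) -> runs (CSeq c1 c2) s (T1 + T2) P.
Proof.
move=> R1 /R1[t1 [s1 [E1 tT1 b1 R2]]].
have [t2 [s2 [E2 tT2 b2 Ps]]] := R2 b1.
by exists (t1 + t2), s2; split=> //; [econstructor; eauto | apply: leq_add].
Qed.

Lemma runs_if x c1 c2 s (P : store -> Prop) :
  consts_le M x && (cost x <= 64) ->
  (eval s x != 0 -> runs c1 s (ctime c1) P) ->
  (eval s x = 0 -> runs c2 s (ctime c2) P) ->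
  runs (CIf x c1 c2) s (ctime (CIf x c1 c2)) P.
Proof.
move=> /andP[cx sx] R1 R2 bs.
have R : runs (if eval s x != 0 then c1 else c2) s (maxn (ctime c1) (ctime c2)) P.
  case: ifPn => [/R1|/negPn/eqP/R2]; apply: runs_weaken => //.
    exact: leq_maxl.
  exact: leq_maxr.
have [t [s' [E tT bs' Ps]]] := R bs; exists (cost x + t).+1, s'.
by split=> //=; [constructor => //; apply: fits_bounded | rewrite ltnS leq_add2l].
Qed.

(** The potential m bounds the time left, so each step has to pay for its own
    body and test; as these take positive time, m is also a termination
    measure. *)
Lemma runs_while x c s m (I : nat -> store -> Prop) (P : store -> Prop) :
  consts_le M x && (cost x <= 64) ->
  (forall m s, I m s -> eval s x = 0 -> P s) ->
  (forall m s, I m s -> eval s x != 0 ->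
     exists T m', T + (cost x).+1 + m' <= m /\ runs c s T (I m')) ->
  I m s -> runs (CWhile x c) s (m + (cost x).+1) P.
Proof.
move=> /andP[cx sx] stop step.
have [k] := ubnP m; elim: k m s => // k IH m s mk Is bs.
have [x0|xN0] := eqVneq (eval s x) 0.
  exists (cost x).+1, s; split=> //; [|exact: leq_addl|exact: stop Is x0].
  by constructor => //; apply: fits_bounded.
have [T [m' [Tm R]]] := step _ _ Is xN0.
have [t1 [s1 [E1 t1T b1 I1]]] := R bs.
have [|t2 [s2 [E2 t2T b2 P2]]] := IH m' s1 _ I1 b1; first by lia.
exists (cost x + t1 + t2).+1, s2; split=> //; last by lia.
by econstructor; eauto; apply: fits_bounded.
Qed.

End Logic.

(** * Scanning adjacency lists *)

(** Registers: the order n, the span l, the current vertex u, the position j in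
    the adjacency array, the neighbour v found there, the two ends of the queue,
    the number k of children of u already placed, and the offsets i and t of a
    child and of its arc.  Arrays: the input, then one array for the labels, the
    queue, the parents, and each further field of a plan; the last array is
    explained at [EWrap]. *)
Notation rN := 0 (only parsing).
Notation rL := 1 (only parsing).
Notation rU := 2 (only parsing).
Notation rJ := 3 (only parsing).
Notation rV := 4 (only parsing).
Notation rHead := 5 (only parsing).
Notation rTail := 6 (only parsing).
Notation rK := 7 (only parsing).
Notation rI := 8 (only parsing).
Notation rT := 9 (only parsing).
Notation aOff := 0 (only parsing).
Notation aAdj := 1 (only parsing).
Notation aLabel := 2 (only parsing).
Notation aQueue := 3 (only parsing).
Notation aPar := 4 (only parsing).
Notation aFirst := 5 (only parsing).
Notation aPpos := 6 (only parsing).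
Notation aAnchor := 7 (only parsing).
Notation aWrap := 8 (only parsing).

(** Truncated subtraction expresses minimum, maximum and inequality without
    a branch. *)
Definition EMin x y := ESub x (ESub x y).
Definition EMax x y := EAdd x (ESub y x).
Definition ENeq x y := EAdd (ESub x y) (ESub y x).
Definition EDeg x :=
  ESub (ECell aOff (EAdd x (EConst 1))) (ECell aOff x).
(** x modulo l for x < 2 * l: the last array holds 0 and l, and
    1 - (l - x) is 1 exactly when x >= l. *)
Definition EWrap x :=
  ESub x (ECell aWrap (ESub (EConst 1) (ESub (EReg rL) x))).
Definition CIncr r := CSet r (EAdd (EReg r) (EConst 1)).

Definition scan (body : cmd) : cmd :=
  CSeq (CSet rJ (ECell aOff (EReg rU)))
  (CWhile (ESub (ECell aOff (EAdd (EReg rU) (EConst 1))) (EReg rJ))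
     (CSeq (CSet rV (ECell aAdj (EReg rJ)))
     (CSeq (CIncr rJ) body))).

Section Scan.
Variables (M W n : nat) (N : 'I_n -> seq 'I_n).
Hypotheses (MW : 64 * M <= W) (M1 : 1 <= M).

Definition arc_start (k : nat) := sumn (take k [seq size (N u) | u <- enum 'I_n]).

Definition graph_in (s : store) : Prop :=
  [/\ reg s rN = n,
      forall k, k <= n -> cell s aOff k = arc_start k
    & forall (u : 'I_n) k, k < size (N u) ->
        cell s aAdj (arc_start u + k) = nth u (N u) k].

Lemma arc_startS (u : 'I_n) : arc_start u.+1 = arc_start u + size (N u).
Proof.
rewrite /arc_start (take_nth 0); last by rewrite size_map size_enum_ord.
by rewrite sumn_rcons (nth_map u) ?size_enum_ord // nth_ord_enum.
Qed.

(** What the body of a scan must preserve. *)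
Definition same_input (s s' : store) : Prop :=
  [/\ reg s' rN = reg s rN, reg s' rU = reg s rU, reg s' rJ = reg s rJ,
      cell s' aOff = cell s aOff & cell s' aAdj = cell s aAdj].

Lemma graph_in_same s s' : same_input s s' -> graph_in s -> graph_in s'.
Proof. by case=> e1 _ _ e2 e3 [g1 g2 g3]; split; rewrite ?e1 // ?e2 ?e3. Qed.

Lemma arc_start_le k k' : k <= k' -> arc_start k <= arc_start k'.
Proof.
rewrite /arc_start => /subnKC <-; rewrite takeD sumn_cat; exact: leq_addr.
Qed.

(** Each entry costs 14 units besides the body: 7 for the loop test, 3 to read
    the neighbour and 4 to advance the position. *)
Lemma runs_scan body s (u : 'I_n) (I : nat -> store -> Prop) :
  graph_in s -> reg s rU = u -> n <= M -> arc_start n <= M ->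
  (forall m s r v, r = rJ \/ r = rV -> I m s -> I m (set_reg s r v)) ->
  (forall m s, m < size (N u) -> I m s -> graph_in s -> reg s rU = u ->
     reg s rV = nth u (N u) m ->
     runs M W body s (ctime body) (fun s' => I m.+1 s' /\ same_input s s')) ->
  I 0 s ->
  runs M W (scan body) s ((ctime body + 14) * size (N u) + 10)
    (fun s' => [/\ I (size (N u)) s', graph_in s' & reg s' rU = u]).
Proof.
move=> gs us nM aM Istable step I0.
have auM : arc_start u.+1 <= M by apply: leq_trans aM; apply: arc_start_le.
have aS := arc_startS u.
rewrite (_ : _ + 10 = 3 + ((ctime body + 14) * size (N u) + 7)); last by lia.
apply: runs_seq; apply: (runs_set MW (v := arc_start u)) => //=.
- by have [_ g2 _] := gs; rewrite us g2 // ltnW.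
- by lia.
pose J m s := exists k, [/\ m = (ctime body + 14) * (size (N u) - k), k <= size (N u),
  I k s, graph_in s & reg s rU = u /\ reg s rJ = arc_start u + k].
apply: (runs_while MW (I := J)) => /=.
- by rewrite !andbT.
- move=> m s' [k [_ k_le Ik g [uE jE]]]; have [_ g2 _] := g.
  rewrite uE addn1 g2 // jE aS subnDl => /eqP; rewrite subn_eq0 => kE.
  by have <- : k = size (N u) by lia.
- move=> m s' [k [-> k_le Ik g [uE jE]]]; have [g1 g2 g3] := g.
  rewrite uE addn1 g2 // jE aS subnDl subn_eq0 -ltnNge => kS.
  exists (3 + (4 + ctime body)), ((ctime body + 14) * (size (N u) - k.+1)).
  split; first by rewrite -(subnSK kS) mulnS; lia.
  apply: runs_seq; apply: (runs_set MW (v := nth u (N u) k)) => //=.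
  + by rewrite jE g3.
  + by apply: leq_trans nM; apply: ltnW.
  apply: runs_seq; apply: (runs_set MW (v := arc_start u + k.+1)) => //=.
  + by rewrite jE addn1 addnS.
  + by lia.
  + by rewrite M1.
  set s2 := set_reg _ _ _.
  have Is2 : I k s2 by do 2?[apply: (Istable); auto].
  apply: (runs_weaken (leqnn _)); last exact: (step k).
  move=> s3 [I3 same3]; exists k.+1; split=> //; last by case: same3 => _ -> -> _ _.
  by apply: graph_in_same same3 _.
- exists 0; split=> //; first by rewrite subn0.
  + by apply: Istable; [left|].
  + by rewrite addn0.
Qed.
End Scan.

(** * Computing the span *)

Definition span_body h :=
  CSet rL (EMax (EReg rL)
    (EAdd (EAdd (EDeg (EReg rU)) (EDeg (EReg rV))) (EConst h.-1))).

Definition span_cmd h :=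
  CWhile (ESub (EReg rN) (EReg rU))
    (CSeq (CSet rL (EMax (EReg rL) (EAdd (EDeg (EReg rU)) (EConst (2 * h).-1))))
    (CSeq (scan (span_body h)) (CIncr rU))).

Section Span.
Variables (M W n h B0 : nat) (e : rel 'I_n) (N : 'I_n -> seq 'I_n).
Hypotheses (MW : 64 * M <= W) (M1 : 1 <= M) (h0 : 0 < h) (hM : 2 * h <= M).
Hypotheses (adj : adjacency_lists e N).
Hypotheses (room : roomy e h B0) (B0M : B0 <= M) (nM : n <= M).
Hypothesis aM : arc_start N n <= M.

Definition covers (l : nat) (u : 'I_n) : Prop :=
  deg e u + 2 * h <= l.+1 /\ forall v, e u v -> deg e u + deg e v + h <= l.+1.

(** The current value is at most every roomy number and is large enough for the
    vertices seen so far; at the end this makes it the least roomy number, with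
    no formula for the maximum. *)
Definition span_inv (k l : nat) : Prop :=
  (forall B, roomy e h B -> l <= B) /\ (forall u : 'I_n, u < k -> covers l u).

Lemma covers_mono l l' u : l <= l' -> covers l u -> covers l' u.
Proof. by move=> ll [c1 c2]; split=> [|v /c2]; lia. Qed.

Lemma eval_deg s x (u : 'I_n) :
  graph_in N s -> eval s x = u -> eval s (EDeg x) = deg e u.
Proof.
case=> _ g2 _ /= ->; rewrite addn1 !g2 //; last by rewrite ltnW.
by rewrite arc_startS addKn (size_adj adj).
Qed.

(** One vertex costs at most 64 units besides its scan, and one adjacency entry
    at most 22 + 14; the arcs not yet scanned serve as potential. *)
Lemma runs_span s :
  graph_in N s -> reg s rU = 0 -> reg s rL = 0 ->
  runs M W (span_cmd h) s (64 * n + 64 * arc_start N n + 4)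
    (fun s' => graph_in N s' /\ span_inv n (reg s' rL)).
Proof.
move=> gs us ls.
pose J m s := exists k, [/\ m = 64 * (n - k) + 64 * (arc_start N n - arc_start N k),
  k <= n, graph_in N s, reg s rU = k & span_inv k (reg s rL)].
apply: (@runs_while _ _ MW _ _ _ (64 * n + 64 * arc_start N n) J) => //.
- move=> m s' [k [_ kn g uE [low cov]]] /=; have [-> _ _] := g; rewrite uE => E.
  split=> //; split=> // v vn; apply: cov; lia.
- move=> m s' [k [-> kn g uE [low cov]]] /=; have [nE _ _] := g.
  rewrite nE uE subn_eq0 -ltnNge => lt_kn.
  pose u := Ordinal lt_kn.
  have aS : arc_start N k.+1 = arc_start N k + size (N u) := arc_startS N u.
  have auM : arc_start N k.+1 <= arc_start N n by apply: arc_start_le.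
  pose T := 14 + (((ctime (span_body h) + 14) * size (N u) + 10) + 4).
  exists T, (64 * (n - k.+1) + 64 * (arc_start N n - arc_start N k.+1)).
  split; first by rewrite /T /=; lia.
  pose l1 := maxn (reg s' rL) (deg e u + (2 * h).-1).
  have l1B B : roomy e h B -> l1 <= B.
    by move=> rB; have := low B rB; have := rB.1 u; rewrite /l1; lia.
  apply: runs_seq; apply: (runs_set MW (v := l1)).
  + by have := eval_deg (x := EReg rU) (u := u) g uE; move=> /= ->; rewrite /l1 maxnE.
  + by apply: leq_trans (l1B _ room) _.
  + by rewrite /= M1 /= !andbT; lia.
  apply: runs_seq.
  pose I m s := [/\ forall B, roomy e h B -> reg s rL <= B,
    forall v : 'I_n, v < k -> covers (reg s rL) v,
    deg e u + 2 * h <= (reg s rL).+1 &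
    forall i, i < m -> deg e u + deg e (nth u (N u) i) + h <= (reg s rL).+1].
  apply: (runs_weaken (leqnn _)); last first.
    apply: (runs_scan MW M1 (u := u) (I := I)) => //.
    * by move=> m1 s1 r v [] ->.
    * move=> m1 s1 lt [l1' c1 d1 i1] g1 u1 v1.
      pose w := nth u (N u) m1.
      have uw : e u w by rewrite -(adj u).2 mem_nth.
      pose l2 := maxn (reg s1 rL) (deg e u + deg e w + h.-1).
      have l2B B : roomy e h B -> l2 <= B.
        by move=> rB; have := l1' B rB; have := rB.2 _ _ uw; rewrite /l2; lia.
      apply: (runs_set MW (v := l2)).
      - have := eval_deg (x := EReg rU) (u := u) g1 u1.
        have := eval_deg (x := EReg rV) (u := w) g1 v1.
        by move=> /= -> ->; rewrite /l2 maxnE.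
      - by apply: leq_trans (l2B _ room) _.
      - by rewrite /= M1 /= !andbT; lia.
      have le2 : reg s1 rL <= l2 by apply: leq_maxl.
      split=> //; split=> //=; [| by lia |].
      - by move=> v vk; apply: covers_mono (c1 _ vk).
      - move=> i; rewrite ltnS leq_eqVlt => /predU1P[->|/i1]; last by lia.
        by rewrite -/w /l2; lia.
    * split=> //=; last by rewrite /l1; lia.
      by move=> v vk; apply: covers_mono (cov _ vk); apply: leq_maxl.
  move=> s2 [[B2 c2 d2 i2] g2 u2].
  apply: (runs_set MW (v := k.+1)) => //=; [by rewrite u2 addn1 | by lia | by rewrite M1 |].
  exists k.+1; split=> //; split=> //= v; rewrite ltnS leq_eqVlt.
  case/predU1P=> [vk|]; last exact: c2.
  have {v vk} -> : v = u by apply: val_inj.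
  split=> // v; rewrite -(adj u).2 => Nv; rewrite -(nth_index u Nv).
  by apply: i2; rewrite index_mem.
- exists 0; split=> //; last by rewrite ls; split.
  by rewrite subn0 /arc_start take0 subn0.
Qed.

Lemma span_inv_roomy l : span_inv n l -> roomy e h l /\ forall B, roomy e h B -> l <= B.
Proof.
by case=> low cov; split=> //; split=> [u|u v uv]; have [] := cov u (ltn_ord u); auto.
Qed.
End Span.

(** * Placing the labels breadth first *)

Definition place_body h :=
  CIf (ENeq (EReg rV) (ECell aPar (EReg rU)))
   (CSeq (CSet rI (EAdd (EReg rK)
      (ESub (EConst 1) (ESub (ECell aPpos (EReg rU)) (EReg rK)))))
   (CSeq (CSet rT (EMin (ECell aAnchor (EReg rU))
      (ESub (ESub (EReg rL) (ESub (EConst h.-1) (EReg rI))) (EDeg (EReg rV)))))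
   (CSeq (CPut aLabel (EReg rV) (EWrap (EAdd (ECell aFirst (EReg rU)) (EReg rI))))
   (CSeq (CPut aFirst (EReg rV) (EWrap (EAdd (ECell aFirst (EReg rU)) (EReg rT))))
   (CSeq (CPut aPpos (EReg rV) (ESub (ECell aAnchor (EReg rU)) (EReg rT)))
   (CSeq (CPut aAnchor (EReg rV) (ESub (EAdd (EReg rI) (EReg rL)) (EReg rT)))
   (CSeq (CPut aPar (EReg rV) (EReg rU))
   (CSeq (CPut aQueue (EReg rTail) (EReg rV))
   (CSeq (CIncr rTail) (CIncr rK))))))))))
   CSkip.

Definition place_init h :=
   CSeq (CPut aQueue (EConst 0) (EConst 0))
  (CSeq (CPut aLabel (EConst 0) (EConst 0))
  (CSeq (CPut aFirst (EConst 0) (EConst h))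
  (CSeq (CPut aPpos (EConst 0) (EDeg (EConst 0)))
  (CSeq (CPut aAnchor (EConst 0) (ESub (EReg rL) (EConst h)))
  (CSeq (CPut aPar (EConst 0) (EReg rN))
  (CSeq (CPut aWrap (EConst 0) (EConst 0))
  (CSeq (CPut aWrap (EConst 1) (EReg rL))
  (CSeq (CSet rHead (EConst 0))
        (CSet rTail (EConst 1)))))))))).

Definition place_loop h :=
  CWhile (ESub (EReg rTail) (EReg rHead))
    (CSeq (CSet rU (ECell aQueue (EReg rHead)))
    (CSeq (CIncr rHead)
    (CSeq (CSet rK (EConst 0))
          (scan (place_body h))))).

Section Place.
Variables (M W n h l : nat) (e : rel 'I_n) (N : 'I_n -> seq 'I_n).
Variables (r : 'I_n) (par : 'I_n -> 'I_n) (depth : 'I_n -> nat).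
Hypotheses (MW : 64 * M <= W) (M1 : 1 <= M) (h0 : 0 < h) (hM : 2 * h <= M).
Hypotheses (adj : adjacency_lists e N) (r0 : r = 0 :> nat).
Hypotheses (room : roomy e h l) (lM : l <= M) (nM : n <= M).
Hypotheses (aM : arc_start N n <= M) (deg_r : 0 < deg e r).
Hypothesis depthS : forall u, u != r -> depth u = (depth (par u)).+1.
Hypothesis edge : forall u v,
  e u v = ((u != r) && (par u == v)) || ((v != r) && (par v == u)).

Notation plan_at := (plan_of e h l r par depth N).
Notation kids_of := (kids r par N).
Notation parent := (is_parent r par).

(** The root is given the non-vertex n as parent, so that no neighbour is
    mistaken for it. *)
Definition par_code (v : 'I_n) : nat := if v == r then n else par v.

(** Q is the whole history of the queue and its first k entries are processed.
    Uniqueness of Q bounds the number of rounds, and the description of its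
    elements forces it to contain all vertices when k reaches its size. *)
Definition bfs_inv k (Q : seq 'I_n) : Prop :=
  [/\ uniq Q, k <= size Q &
     forall v, (v \in Q) = (v == r) || (v != r) && (par v \in take k Q)].

Lemma bfs_start : bfs_inv 0 [:: r].
Proof. by split=> // v; rewrite !inE andbF orbF. Qed.

Lemma bfs_head k Q : uniq Q -> k < size Q ->
  let u := nth r Q k in
  take k.+1 (Q ++ kids_of u) = rcons (take k Q) u /\ u \notin take k Q.
Proof.
move=> uQ kQ u; split; first by rewrite takel_cat // (take_nth r).
by move: (take_uniq k.+1 uQ); rewrite (take_nth r) // rcons_uniq => /andP[].
Qed.

Lemma bfs_step k Q :
  bfs_inv k Q -> k < size Q -> bfs_inv k.+1 (Q ++ kids_of (nth r Q k)).
Proof.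
case=> uQ kQ memQ kQlt; set u := nth r Q k.
have uk := mem_kids depthS edge adj u.
have [takeS u_new] := bfs_head uQ kQlt.
split=> [||v].
- rewrite cat_uniq uQ (uniq_kids r par adj) andbT /=.
  apply/hasPn => v; rewrite uk memQ => /andP[vr /eqP ->].
  by rewrite (negbTE vr).
- by rewrite size_cat; lia.
- rewrite takeS mem_cat mem_rcons inE uk memQ /is_parent.
  by case: (v == r) => //=; case: (par v == u); rewrite ?orbT ?orbF.
Qed.

(** By induction on the depth: once everything queued is processed, the children
    of queued vertices are queued. *)
Lemma bfs_end Q : bfs_inv (size Q) Q -> forall v, v \in Q.
Proof.
case=> _ _ memQ v; have [m] := ubnP (depth v); elim: m v => // m IH v lem.
rewrite memQ take_size; have [//|vr] := eqVneq v r.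
by apply: IH; have := depthS vr; lia.
Qed.

Definition stored s (v : 'I_n) : Prop :=
  [/\ cell s aLabel v = label (plan_at v), cell s aFirst v = first (plan_at v),
      cell s aPpos v = ppos (plan_at v), cell s aAnchor v = anchor (plan_at v)
    & cell s aPar v = par_code v].

Definition place_inv k Q s : Prop :=
  [/\ reg s rL = l, cell s aWrap 0 = 0 /\ cell s aWrap 1 = l,
      reg s rHead = k /\ reg s rTail = size Q,
      forall i, i < size Q -> cell s aQueue i = nth r Q i
    & forall v, v \in Q -> stored s v].

Lemma eval_wrap s x y :
  reg s rL = l -> cell s aWrap 0 = 0 /\ cell s aWrap 1 = l ->
  eval s x = y -> y < 2 * l -> eval s (EWrap x) = y %% l.
Proof.
move=> lE [w0 w1] /= ->; rewrite lE => lt.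
have [yl|ly] := ltnP y l.
  have -> : 1 - (l - y) = 0 by lia.
  by rewrite w0 subn0 modn_small.
have -> : 1 - (l - y) = 1 by lia.
by rewrite w1 -{2}(subnK ly) modnDr modn_small //; lia.
Qed.

(** The number of children already placed is the index of v among the children
    of u, so the values computed are those of [child_plan].  As v is new to the
    queue, storing them leaves the entries of the earlier vertices untouched. *)
Lemma runs_place_body s (u : 'I_n) m Q :
  graph_in N s -> reg s rU = u -> m < size (N u) -> reg s rV = nth u (N u) m ->
  u \in Q ->
  let done := [seq v <- take m (N u) | ~~ parent u v] in
  let done' := [seq v <- take m.+1 (N u) | ~~ parent u v] in
  uniq (Q ++ done') -> forall k,
  place_inv k (Q ++ done) s -> reg s rK = size done ->
  runs M W (place_body h) s (ctime (place_body h))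
    (fun s' => (place_inv k (Q ++ done') s' /\ reg s' rK = size done') /\
               same_input s s').
Proof.
move=> g uE mN vE uQ done done' uniqQ k [lE wE [hE tE] qE sE] kE.
have [nE g2 g3] := g.
set v := nth u (N u) m in vE.
have uv : e u v by rewrite -(adj u).2 mem_nth.
have done'E : done' = if ~~ parent u v then rcons done v else done.
  by rewrite /done' (take_nth u) // -/v filter_rcons.
have [_ _ _ _ pE] : stored s u by apply: sE; rewrite mem_cat uQ.
have parent_eq : (par_code u == v) = parent u v.
  rewrite /par_code /is_parent; have [_|_] := eqVneq u r => //=.
  by apply/eqP; have := ltn_ord v; lia.
apply: (runs_if MW) => //=; rewrite vE uE pE => neq; last first.
  have uvp : parent u v by rewrite -parent_eq; apply/eqP; lia.
  rewrite uvp in done'E.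
  by apply: runs_skip; split; last by []; rewrite done'E.
have {neq} uvp : ~~ parent u v by rewrite -parent_eq; apply/eqP; lia.
have [su1 su2 su3 su4 _] : stored s u by apply: sE; rewrite mem_cat uQ.
rewrite uvp in done'E.
have vu : parent v u by move: uv; rewrite edge -/(parent u v) (negbTE uvp).
have idx : index v (kids_of u) = size done.
  rewrite /kids -(cat_take_drop m (N u)) (drop_nth u) // -/v filter_cat /= uvp.
  rewrite index_cat /= eqxx addn0; case: ifP => // vd.
  move: uniqQ; rewrite done'E cat_uniq rcons_uniq vd.
  by rewrite /= !andbF.
pose i := pos e h l r par depth N u v.
have iE : i = bump (ppos (plan_at u)) (size done).
  by rewrite /i /pos (negbTE uvp) idx.
have i_lt : i < deg e u := pos_lt depthS edge adj h0 room deg_r uv.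
pose t := child_first h l (plan_at u) i (deg e v).
have vE' := plan_of_child h l depthS edge adj vu; rewrite -/i in vE'.
have sp := (plan_sound depthS edge adj h0 room deg_r u).1.
have spv := (plan_sound depthS edge adj h0 room deg_r v).1.
have vl := label_lt depthS edge adj h0 room deg_r v.
have [t_anchor t_l] : t <= anchor (plan_at u) /\ t <= l by apply: child_first_bounds.
have dul : deg e u < l := deg_lt depthS edge adj h0 room deg_r u.
have [_ f_lt _ a_le] := sp.
have [_ fv_lt _ av_le] := spv.
have size_done' : size done' = (size done).+1 by rewrite done'E size_rcons.
have sizeQ : size (Q ++ done) < n.
  have := max_card (mem (Q ++ done')); rewrite card_ord (card_uniqP uniqQ).
  by rewrite !size_cat size_done' addnS.
have [h1M ?] : h.-1 <= M /\ h <= M by lia.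
apply: runs_seq; apply: (runs_set MW (v := i)) => /=.
- by rewrite kE uE su3 iE /bump addnC; congr (_ + _); lia.
- by lia.
- by rewrite M1.
apply: runs_seq; apply: (runs_set MW (v := t)).
- have := @eval_deg n e N adj s (EReg rV) v g vE.
  move=> /= ->; rewrite uE lE su4 /t /child_first /minn; case: ltnP; lia.
- by lia.
- by rewrite /= h1M M1.
apply: runs_seq; apply: (runs_put MW (k := v) (v := label (plan_at v))).
- by [].
- by rewrite vE' [label _]/=; apply: eval_wrap => //=; [rewrite uE su2 | lia].
- by lia.
- by rewrite /= M1.
apply: runs_seq; apply: (runs_put MW (k := v) (v := first (plan_at v))).
- by [].
- by rewrite vE' [first _]/=; apply: eval_wrap => //=; [rewrite uE su2 | lia].
- by lia.
- by rewrite /= M1.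
apply: runs_seq; apply: (runs_put MW (k := v) (v := ppos (plan_at v))) => //=.
- by rewrite uE su4 vE'.
- by rewrite vE' /=; lia.
apply: runs_seq; apply: (runs_put MW (k := v) (v := anchor (plan_at v))) => //=.
- by rewrite lE vE'.
- by lia.
apply: runs_seq; apply: (runs_put MW (k := v) (v := u)) => //=.
- by apply: leq_trans nM; apply: ltnW.
apply: runs_seq; apply: (runs_put MW (k := size (Q ++ done)) (v := v)) => //=.
- by apply: leq_trans nM; apply: ltnW.
apply: runs_seq; apply: (runs_set MW (v := size (Q ++ done'))) => //=.
- by rewrite tE addn1 !size_cat size_done' addnS.
- by rewrite size_cat size_done' addnS; move: sizeQ; rewrite size_cat => /leq_trans->.
- by rewrite M1.
apply: (runs_set MW (v := size done')) => //=.
- by rewrite kE size_done' addn1.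
- rewrite size_done'; move: sizeQ; rewrite size_cat => sQ.
  by apply: leq_trans nM; apply: leq_ltn_trans sQ; apply: leq_addl.
- by rewrite M1.
have QE : Q ++ done' = rcons (Q ++ done) v by rewrite done'E rcons_cat.
split; last by [].
split=> //; split=> //=.
- by move=> j; rewrite QE size_rcons ltnS nth_rcons; case: ltngtP => // /qE.
- move=> w; rewrite QE mem_rcons inE => /predU1P[->|wQ].
    split; rewrite /= ?eqxx //.
    by rewrite /par_code; case/andP: vu => /negbTE -> /eqP ->.
  have wv : w != v.
    by apply: contraTneq uniqQ => wv; rewrite QE rcons_uniq -wv wQ.
  have wv' : (w == v :> nat) = false by apply/negbTE.
  by have [? ? ? ? ?] := sE w wQ; split; rewrite /= ?wv'.
Qed.

(** A vertex costs 3 + 4 + 2 units to start its scan, 10 around the scan, and 4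
    for the loop test, at most 32 in all; an adjacency entry costs 98 + 14.  The
    potential sums these over the vertices not yet processed. *)
Lemma runs_place_loop s :
  graph_in N s -> place_inv 0 [:: r] s ->
  runs M W (place_loop h) s (\sum_u (32 + 112 * deg e u) + 4)
    (fun s' => reg s' rL = l /\ forall v : 'I_n, cell s' aLabel v = label (plan_at v)).
Proof.
move=> gs inv0.
pose J m s := exists k Q, [/\ m = \sum_(u | u \notin take k Q) (32 + 112 * deg e u),
  bfs_inv k Q, graph_in N s & place_inv k Q s].
apply: (@runs_while _ _ MW _ _ _ _ J) => //.
- move=> m s' [k [Q [_ bQ _ [lE _ [hE tE] _ sE]]]] /=; rewrite hE tE => E.
  split=> // v; suff : v \in Q by case/sE.
  apply: bfs_end; have [_ kQ _] := bQ.
  by have -> : size Q = k by apply/eqP; rewrite eqn_leq kQ andbT -subn_eq0 E.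
- move=> m s' [k [Q [-> bQ g [lE wE [hE tE] qE sE]]]] /=.
  rewrite hE tE subn_eq0 -ltnNge => kQ.
  pose u := nth r Q k; have uQ : u \in Q by apply: mem_nth.
  have [uniqQ _ _] := bQ.
  have bQ' := bfs_step bQ kQ; have [uniqQ' _ _] := bQ'.
  have [takeS u_new] := bfs_head uniqQ kQ.
  exists (3 + (4 + (2 + ((ctime (place_body h) + 14) * size (N u) + 10)))).
  exists (\sum_(v | v \notin take k.+1 (Q ++ kids_of u)) (32 + 112 * deg e v)).
  have sizeQ : size Q <= n.
    by have := max_card (mem Q); rewrite card_ord (card_uniqP uniqQ).
  split.
    rewrite (bigD1 u u_new) takeS (size_adj adj).
    have -> : ctime (place_body h) = 98 by [].
    rewrite (eq_bigl (fun v => (v \notin take k Q) && (v != u))); first by rewrite /=; lia.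
    by move=> v; rewrite mem_rcons inE negb_or andbC.
  pose done m := [seq v <- take m (N u) | ~~ parent u v].
  apply: runs_seq; apply: (runs_set MW (v := u)) => /=.
  + by rewrite hE qE.
  + by apply: leq_trans nM; apply: ltnW.
  + by [].
  apply: runs_seq; apply: (runs_set MW (v := k.+1)) => /=.
  + by rewrite hE addn1.
  + by apply: leq_trans nM; apply: leq_trans sizeQ.
  + by rewrite M1.
  apply: runs_seq; apply: (runs_set MW (v := 0)) => //=.
  pose I m s := place_inv k.+1 (Q ++ done m) s /\ reg s rK = size (done m).
  apply: (runs_weaken (leqnn _)); last first.
    apply: (runs_scan MW M1 (u := u) (I := I)) => //.
    * by move=> m1 s1 x v [] ->.
    * move=> m1 s1 lt [i1 k1] g1 u1 v1.
      apply: (runs_place_body g1 u1 lt v1 uQ) => //.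
      apply: subseq_uniq uniqQ'; rewrite subseq_cat2l.
      rewrite /kids -{2}(cat_take_drop m1.+1 (N u)) filter_cat; exact: prefix_subseq.
    * by rewrite /I /done take0 cats0; split.
  move=> s2 [[inv2 _] g2 u2].
  exists k.+1, (Q ++ kids_of u); split=> //.
  by move: inv2; rewrite /done take_size.
- exists 0, [:: r]; split=> //; exact: bfs_start.
Qed.

Lemma runs_place_init s :
  graph_in N s -> reg s rL = l ->
  runs M W (place_init h) s (ctime (place_init h))
    (fun s' => graph_in N s' /\ place_inv 0 [:: r] s').
Proof.
move=> g lE; have [nE g2 g3] := g.
have dr : deg e r <= M by apply: leq_trans nM; rewrite -[n in _ <= n]card_ord max_card.
apply: runs_seq; apply: (runs_put MW (k := 0) (v := 0)) => //=.
apply: runs_seq; apply: (runs_put MW (k := 0) (v := 0)) => //=.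
apply: runs_seq; apply: (runs_put MW (k := 0) (v := h)) => //=; [lia | by rewrite andbT; lia |].
apply: runs_seq; apply: (runs_put MW (k := 0) (v := deg e r)) => //.
- by apply: (@eval_deg n e N adj _ _ r); rewrite /= ?r0.
- by rewrite /= M1.
apply: runs_seq; apply: (runs_put MW (k := 0) (v := l - h)) => //=.
- by rewrite lE.
- by lia.
- by rewrite andbT; lia.
apply: runs_seq; apply: (runs_put MW (k := 0) (v := n)) => //=.
apply: runs_seq; apply: (runs_put MW (k := 0) (v := 0)) => //=.
apply: runs_seq; apply: (runs_put MW (k := 1) (v := l)) => //=; first by rewrite M1.
apply: runs_seq; apply: (runs_set MW (v := 0)) => //=.
apply: (runs_set MW (v := 1)) => //=; first by rewrite M1.
split; first by split.
split=> //=; first by case=> [|i] //= _; rewrite r0.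
move=> v; rewrite inE => /eqP ->; rewrite /stored /= r0 plan_of_root /par_code.
by split=> //=; rewrite eqxx.
Qed.

End Place.

(** * The algorithm *)

Definition labelling_program h :=
  CSeq (span_cmd h)
  (CSeq (place_init h)
  (CSeq (place_loop h)
        (CSet rN (EReg rL)))).

(** The offsets of the input are the positions at which the lists start in their
    concatenation. *)
Lemma nth_flatten_arc (T : Type) (x0 : T) (ss : seq (seq T)) i k :
  k < size (nth [::] ss i) ->
  nth x0 (flatten ss) (sumn (take i (shape ss)) + k) = nth x0 (nth [::] ss i) k.
Proof.
elim: ss i => [|s ss IH] [|i] //= lt; first by rewrite add0n nth_cat lt.
by rewrite nth_cat -addnA ltnNge leq_addr /= addKn IH.
Qed.

Section Input.
Variables (n : nat) (e : rel 'I_n) (N : 'I_n -> seq 'I_n).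
Hypothesis adj : adjacency_lists e N.

Lemma arc_start_sum : arc_start N n = \sum_u deg e u.
Proof.
rewrite /arc_start take_oversize ?size_map -?enumT ?size_enum_ord //.
by rewrite sumnE big_map big_enum /=; apply: eq_bigr => u _; rewrite (size_adj adj).
Qed.

Lemma shape_lists :
  shape [seq map val (N u) | u <- enum 'I_n] = [seq size (N u) | u <- enum 'I_n].
Proof. by rewrite /shape -map_comp; apply: eq_map => u /=; rewrite size_map. Qed.

Notation lists := [seq map val (N u) | u <- enum 'I_n].

Lemma input_offset k : k <= n -> cell (input N) aOff k = arc_start N k.
Proof.
move=> kn.
rewrite -[LHS]/(nth 0 [seq sumn (take i (shape lists)) | i <- iota 0 n.+1] k).
by rewrite (nth_map 0) ?size_iota // nth_iota // add0n shape_lists.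
Qed.

Lemma graph_in_input : graph_in N (input N).
Proof.
split=> // [|u k ku]; first exact: input_offset.
have nE : nth [::] lists u = map val (N u).
  by rewrite (nth_map u) ?nth_ord_enum // size_enum_ord.
rewrite -[LHS]/(nth 0 (flatten lists) (arc_start N u + k)) /arc_start -shape_lists.
by rewrite nth_flatten_arc nE ?size_map // (nth_map u).
Qed.

Lemma bounded_input M : n <= M -> arc_start N n <= M -> bounded M (input N).
Proof.
move=> nM aM; split=> [x|[|[|a]] i]; first by rewrite /=; case: ifP.
- have [lt|ge] := leqP i n.
    by rewrite input_offset //; apply: leq_trans aM; apply: arc_start_le.
  rewrite -[cell _ _ _]/(nth 0 [seq sumn (take i (shape lists)) | i <- iota 0 n.+1] i).
  by rewrite nth_default // size_map size_iota.
- rewrite -[cell _ _ _]/(nth 0 (flatten lists) i).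
  have [lt|ge] := ltnP i (size (flatten lists)); last by rewrite nth_default.
  have /flatten_mapP[u _ /mapP[v _ ->]] := mem_nth 0 lt.
  by apply: leq_trans nM; apply: ltnW (ltn_ord v).
- by [].
Qed.

End Input.

Lemma labelling_program_correct h : 0 < h ->
  exists c, forall n (e : rel 'I_n) (N : 'I_n -> seq 'I_n),
    is_tree e -> 0 < Delta e -> adjacency_lists e N ->
    exists (t : nat) (s : store) (l : nat) (f : {ffun 'I_n -> 'I_l}),
      [/\ exec (c * n ^ 1) (labelling_program h) (input N) t s, t <= c * n,
          outputs s f, C_labelling e h 1 1 f
        & 4 * l <= 5 * sigma e h 1 1].
Proof.
move=> h0; exists (64 * (2 * h + 4) + 600) => n e N tree D0 adj.
have [_ _ V0 conn _] := tree; have n0 : 0 < n by rewrite card_ord in V0.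
pose r : 'I_n := Ordinal n0.
have [par [depth [depthS edge]]] := tree_parents tree r.
have deg_r : 0 < deg e r.
  have [u Du] := eq_bigmax (deg e) V0; rewrite -/(Delta e) in Du.
  have [<-|ur] := eqVneq u r; first by rewrite -Du.
  case/connectP: (conn r u) => -[|w p] /=; first by move=> _ E; rewrite E eqxx in ur.
  by case/andP=> rw _ _; apply: deg_gt0 rw.
have degn u : deg e u <= n by rewrite -[n in _ <= n]card_ord max_card.
have sumd : \sum_u deg e u <= 2 * n by have := sum_deg_le tree; rewrite card_ord.
(* M bounds all stored values: positions and adjacency entries are at most 2n,
   and the span at most 2n + 2h by minimality; 600 n bounds the time. *)
pose M := (2 * h + 4) * n; pose W := (64 * (2 * h + 4) + 600) * n ^ 1.
have MW : 64 * M <= W by rewrite /M /W; nia.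
have [M1 hM nM n2M] : [/\ 1 <= M, 2 * h <= M, n <= M & 2 * n + 2 * h <= M].
  by rewrite /M; split; nia.
have aM : arc_start N n <= M by rewrite (arc_start_sum adj); lia.
have room0 : roomy e h (2 * n + 2 * h).
  by split=> [u|u v _]; have := degn u; [|have := degn v]; lia.
pose T := (64 * n + 64 * arc_start N n + 4) +
  (ctime (place_init h) + ((\sum_u (32 + 112 * deg e u) + 4) + 2)).
have T_le : T <= 600 * n.
  have sumE : \sum_u (32 + 112 * deg e u) = 32 * n + 112 * \sum_u deg e u.
    by rewrite big_split big_distrr sum_nat_const card_ord mulnC.
  have initE : ctime (place_init h) = 36 by [].
  by rewrite /T (arc_start_sum adj) sumE initE; lia.
have R : runs M W (labelling_program h) (input N) T
  (fun s => exists l (f : {ffun 'I_n -> 'I_l}),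
     [/\ outputs s f, C_labelling e h 1 1 f & 4 * l <= 5 * sigma e h 1 1]).
  apply: runs_seq; apply: (runs_weaken (leqnn _)); last first.
    by apply: (runs_span MW M1 h0 hM adj room0 n2M nM aM) => //; apply: graph_in_input.
  move=> s1 [g1 /span_inv_roomy[]]; move lE: (reg s1 rL) => l room least.
  have lM : l <= M by apply: leq_trans n2M; apply: least.
  apply: runs_seq; apply: (runs_weaken (leqnn _)); last first.
    exact: (@runs_place_init M W n h l e N r par depth).
  move=> s2 [g2 inv2].
  apply: runs_seq; apply: (runs_weaken (leqnn _)); last first.
    exact: (@runs_place_loop M W n h l e N r par depth).
  move=> s3 [l3 lab3]; apply: (runs_set MW (v := l)) => //.
  have lt := label_lt depthS edge adj h0 room deg_r.
  exists l, [ffun u => Ordinal (lt u)]; split.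
  - by split=> // v; rewrite ffunE /= lab3.
  - by apply: (C_labelling_plan depthS edge adj h0 room deg_r) => u; rewrite ffunE.
  - by have := least _ (roomy_sigma tree h0 D0); lia.
have [t [s [E tT _ [l [f [out lab ratio]]]]]] := R (bounded_input nM aM).
exists t, s, l, f; split=> //; apply: leq_trans tT _; apply: leq_trans T_le _.
by rewrite leq_mul2r leq_addl orbT.
Qed.

Theorem theorem5p4 (h : nat) (h_ge1 : 1 <= h) :
  exists P : cmd,
    linear_time_approx h P
      (fun n (e : rel 'I_n) => 3 <= Delta e)
      (fun n (e : rel 'I_n) =>
        let D : rat := ((Delta e)%:R)%R in
        let eps : rat := ((2 * D - 3) / (2 * D + 4))%R in
        (1 + eps)%R)
    /\
    linear_time_approx h P
      (fun n (e : rel 'I_n) =>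
        3 <= Delta e /\
        (Delta2 e = 2 * Delta e - 1 \/ Delta2 e = 2 * Delta e))
      (fun n (e : rel 'I_n) => (14 / 10)%R).
Proof.
exists (labelling_program h).
have [c correct] := labelling_program_correct h_ge1.
have approx (K : forall n, rel 'I_n -> Prop) (rho : forall n, rel 'I_n -> rat) :
  (forall n (e : rel 'I_n), K n e -> 3 <= Delta e /\ (5 / 4 <= rho n e)%R) ->
  linear_time_approx h (labelling_program h) K rho.
  move=> Krho; exists c, 1 => n e N tree /Krho[D3 rho54] adj.
  have [|t [s [l [f [E tn out lab ratio]]]]] := correct n e N tree _ adj; first by lia.
  exists t, s, l, f; split=> //.
  have : ((4 * l)%N%:R <= (5 * sigma e h 1 1)%N%:R :> rat)%R by rewrite ler_nat.
  rewrite !natrM => ratio'.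
  have : (0 <= (sigma e h 1 1)%:R :> rat)%R by apply: ler0n.
  move=> sigma_ge0; apply: le_trans (ler_wpM2r sigma_ge0 rho54).
  by move: ratio'; move: (l%:R)%R ((sigma e h 1 1)%:R)%R => a b; lra.
split; apply: approx => n e; last by case=> D3 _; split; [exact: D3 | lra].
move=> D3; split; first exact: D3.
have : (3 <= (Delta e)%:R :> rat)%R by rewrite (ler_nat _ 3).
move: ((Delta e)%:R)%R => D D3' /=.
have D_gt0 : (0 < 2 * D + 4 :> rat)%R by lra.
have : (1 / 4 <= (2 * D - 3) / (2 * D + 4))%R by rewrite ler_pdivlMr //; lra.
lra.
Qed.
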